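(* For any projection algebra $P$ we have $$\mathscr C(P)\cong\pi_1(G_P)\qquad\text{and}\qquad\overline{\mathscr C}(P)\cong\pi_1(K_P)\cong\pi_1(K_P'),$$ as (unordered) groupoids.
   Context: Maps are written to the right of their arguments and composed left to right. A projection algebra is a set $P$ with unary operations $\theta_p:P\to P$ ($p\in P$) such that for all $p,q\in P$: $p\theta_p=p$; $\theta_p\theta_p=\theta_p$; $p\theta_q\theta_p=q\theta_p$; $\theta_p\theta_q\theta_p=\theta_{q\theta_p}$; $\theta_p\theta_q\theta_p\theta_q=\theta_p\theta_q$. On $P$ define $p\leq q$ iff $p=p\theta_q$; $p\leq_{\mathscr F}q$ iff $p=q\theta_p$; $p\mathrel{\mathscr F}q$ iff $p\leq_{\mathscr F}q$ and $q\leq_{\mathscr F}p$. A $P$-path is a tuple $(p_1,\ldots,p_k)$ ($k\geq1$) with $p_1\mathrel{\mathscr F}\cdots\mathrel{\mathscr F}p_k$, regarded as a morphism $p_1\to p_k$; the path category $\mathscr P=\mathscr P(P)$ consists of all $P$-paths under $(p_1,\ldots,p_k)\circ(p_k,\ldots,p_l)=(p_1,\ldots,p_k,\ldots,p_l)$, with identities $(p)$. For $p\in P$, a pair $(e,f)\in P\times P$ is $p$-linked if $f=e\theta_p\theta_f$ and $e=f\theta_p\theta_e$; then $\lambda(e,p,f)=(e,e\theta_p,f)$ and $\rho(e,p,f)=(e,f\theta_p,f)$ are $P$-paths. Let $\approx$ be the (category) congruence on $\mathscr P$ generated by (1) all $((p,p),(p))$ with $p\in P$ and (2) all $((p,q,p),(p))$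 with $p\mathrel{\mathscr F}q$; let $\equiv$ be the congruence generated by (1), (2) and (3) all $(\lambda(e,p,f),\rho(e,p,f))$ with $p\in P$ and $(e,f)$ $p$-linked. The chain groupoid is $\mathscr C(P)=\mathscr P/{\approx}$ and the reduced chain groupoid is $\overline{\mathscr C}(P)=\mathscr P/{\equiv}$. A $p$-linked pair $(e,f)$ is special if $e=e\theta_p$ or $f=f\theta_p$ (i.e. $e\leq p$ or $f\leq p$), and degenerate if $\lambda(e,p,f)\approx\rho(e,p,f)$. Write $e'=e\theta_p$ and $f'=f\theta_p$. $G_P$ is the graph with vertex set $P$ and an undirected edge $\{p,q\}$ for each pair of distinct $p,q\in P$ with $p\mathrel{\mathscr F}q$. $K_P$ is the $2$-complex with $1$-skeleton $G_P$ and a $2$-cell with boundary $(e,e',f,f',e)$ for every $p\in P$ and every $p$-linked pair $(e,f)$ (steps between equal vertices being read as constant). $K_P'$ is the subcomplex of $K_P$ with the same $1$-skeleton and only the $2$-cells corresponding to non-degenerate special $p$-linked pairs $(e,f)$ ($p\in P$); for such a pair, $\{e,f,e',f'\}$ has size $3$, and the cell has boundary $(e,f,f',e)$ if $e\leq p$, and $(e,e',f,e)$ if $f\leq p$. $\pi_1(\cdot)$ denotes the fundamental groupoid on the vertex set $P$, whose morphisms are homotopy classes (rel endpoints) of edge paths between vertices. *)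

(* Defs.v *)
From mathcomp Require Import all_boot generic_quotient.
From mathcomp Require Import boolp.

Set Implicit Arguments.
Unset Strict Implicit.
Unset Printing Implicit Defensive.

Local Open Scope quotient_scope.

(* Composition is written in diagrammatic order: [f >>> g] is first f, then g. *)
Record category := Category {
  obj :> Type;
  hom : obj -> obj -> Type;
  idm : forall x, hom x x;
  comp : forall x y z, hom x y -> hom y z -> hom x z;
  comp1m : forall x y (f : hom x y), comp (idm x) f = f;
  compm1 : forall x y (f : hom x y), comp f (idm y) = f;
  compA : forall x y z t (f : hom x y) (g : hom y z) (h : hom z t),
    comp f (comp g h) = comp (comp f g) h }.

Arguments idm {c} x.
Arguments comp {c x y z} f g.
Notation "f >>> g" := (comp f g) (at level 50, left associativity).

Lemma invertible_comp (C : category) (x y z : C) (a : hom x y) (b : hom y x)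
    (f : hom y z) (g : hom z y) :
    a >>> b = idm x -> b >>> a = idm y -> f >>> g = idm y -> g >>> f = idm z ->
  exists h : hom z x, (a >>> f) >>> h = idm x /\ h >>> (a >>> f) = idm z.
Proof.
move=> ab ba fg gf; exists (g >>> b); split.
  by rewrite compA -(compA a) fg compm1.
by rewrite compA -(compA g) ba compm1.
Qed.

Record groupoid := Groupoid {
  gcat :> category;
  ginvertible : forall (x y : gcat) (f : hom x y),
    exists g : hom y x, f >>> g = idm x /\ g >>> f = idm y }.

Record functor (C D : category) := Functor {
  fobj :> C -> D;
  fmap : forall x y, hom x y -> hom (fobj x) (fobj y);
  fmap1 : forall x, fmap (idm x) = idm (fobj x);
  fmapM : forall x y z (f : hom x y) (g : hom y z),
    fmap (f >>> g) = fmap f >>> fmap g }.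

Definition groupoid_isomorphic (G H : groupoid) : Prop :=
  exists F : functor G H,
    bijective (fobj F) /\ forall x y : G, bijective (@fmap G H F x y).

Notation "G ≅ H" := (groupoid_isomorphic G H) (at level 70, no associativity).

Definition hom_rel (C : category) := forall x y : C, hom x y -> hom x y -> Prop.

Inductive congruence (C : category) (R : hom_rel C) :
    forall x y : C, hom x y -> hom x y -> Prop :=
| CongGen x y (f g : hom x y) : R x y f g -> congruence R f g
| CongRefl x y (f : hom x y) : congruence R f f
| CongSym x y (f g : hom x y) : congruence R f g -> congruence R g f
| CongTrans x y (f g h : hom x y) :
    congruence R f g -> congruence R g h -> congruence R f h
| CongComp x y z (f f' : hom x y) (g g' : hom y z) :
    congruence R f f' -> congruence R g g' ->
    congruence R (f >>> g) (f' >>> g').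

Section QuotientCategory.
Variables (C : category) (R : hom_rel C).

Definition cong_rel (x y : C) : rel {classic hom x y} :=
  fun f g => `[< congruence R f g >].

Lemma cong_rel_refl x y : reflexive (@cong_rel x y).
Proof. by move=> f; apply/asboolP/CongRefl. Qed.

Lemma cong_rel_sym x y : symmetric (@cong_rel x y).
Proof. by move=> f g; apply/asboolP/asboolP; apply: CongSym. Qed.

Lemma cong_rel_trans x y : transitive (@cong_rel x y).
Proof.
move=> g f h /asboolP fg /asboolP gh; apply/asboolP; exact: CongTrans fg gh.
Qed.

Canonical cong_equiv x y := EquivRel (@cong_rel x y)
  (@cong_rel_refl x y) (@cong_rel_sym x y) (@cong_rel_trans x y).

Definition quotient_hom (x y : C) : Type := {eq_quot cong_equiv x y}.

Definition hom_class x y (f : hom x y) : quotient_hom x y :=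
  \pi_({eq_quot cong_equiv x y}) (f : {classic hom x y}).

Definition hom_repr x y (u : quotient_hom x y) : hom x y :=
  repr (u : {eq_quot cong_equiv x y}).

Lemma hom_classP x y (f g : hom x y) :
  hom_class f = hom_class g <-> congruence R f g.
Proof.
split; last by move=> fg; apply/eqmodP/asboolP.
by move=> /eqmodP /asboolP.
Qed.

Lemma hom_reprK x y (u : quotient_hom x y) : hom_class (hom_repr u) = u.
Proof. exact: reprK. Qed.

Definition quotient_comp x y z (u : quotient_hom x y) (v : quotient_hom y z) :=
  hom_class (hom_repr u >>> hom_repr v).

Lemma quotient_compE x y z (f : hom x y) (g : hom y z) :
  quotient_comp (hom_class f) (hom_class g) = hom_class (f >>> g).
Proof. by apply/hom_classP/CongComp; apply/hom_classP; rewrite hom_reprK. Qed.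

Lemma quotient_comp1m x y (u : quotient_hom x y) :
  quotient_comp (hom_class (idm x)) u = u.
Proof. by rewrite -(hom_reprK u) quotient_compE comp1m. Qed.

Lemma quotient_compm1 x y (u : quotient_hom x y) :
  quotient_comp u (hom_class (idm y)) = u.
Proof. by rewrite -(hom_reprK u) quotient_compE compm1. Qed.

Lemma quotient_compA x y z t (u : quotient_hom x y) (v : quotient_hom y z)
    (w : quotient_hom z t) :
  quotient_comp u (quotient_comp v w) = quotient_comp (quotient_comp u v) w.
Proof.
by rewrite -(hom_reprK u) -(hom_reprK v) -(hom_reprK w) !quotient_compE compA.
Qed.

Definition quotient_category : category :=
  Category quotient_comp1m quotient_compm1 quotient_compA.

End QuotientCategory.

Section Walks.
Variables (V : Type) (e : rel V).

Definition is_walk (x y : V) (s : seq V) : bool :=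
  path e x s && `[< last x s = y >].

(* The walk (x, s_1, ..., s_k) from x to y = last x s is stored as the sequence
   s of its steps, without the initial vertex. *)
Definition walk (x y : V) : Type := {s : seq V | is_walk x y s}.

Definition vertices x y (w : walk x y) : seq V := x :: val w.

Definition mk_walk x y s (h : is_walk x y s) : walk x y :=
  exist (is_walk x y) s h.

Lemma walk_inj x y (w w' : walk x y) : val w = val w' -> w = w'.
Proof.
case: w w' => [s sP] [s' s'P] /= ss'; move: s'P; rewrite -ss' => s'P.
by rewrite (bool_irrelevance sP s'P).
Qed.

Lemma walk0P x : is_walk x x [::].
Proof. by apply/asboolP. Qed.

Lemma walk_catP x y z (s t : seq V) :
  is_walk x y s -> is_walk y z t -> is_walk x z (s ++ t).
Proof.
move=> /andP[ps /asboolP sy] /andP[pt /asboolP tz]; apply/andP.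
by rewrite cat_path last_cat sy ps pt; split=> //; apply/asboolP.
Qed.

Definition walk0 x : walk x x := mk_walk (walk0P x).

Definition walk_comp x y z (w : walk x y) (w' : walk y z) : walk x z :=
  mk_walk (walk_catP (valP w) (valP w')).

Lemma walk_comp1m x y (w : walk x y) : walk_comp (walk0 x) w = w.
Proof. exact: walk_inj. Qed.

Lemma walk_compm1 x y (w : walk x y) : walk_comp w (walk0 y) = w.
Proof. by apply: walk_inj; rewrite /= cats0. Qed.

Lemma walk_compA x y z t (u : walk x y) (v : walk y z) (w : walk z t) :
  walk_comp u (walk_comp v w) = walk_comp (walk_comp u v) w.
Proof. by apply: walk_inj; rewrite /= catA. Qed.

Definition walk_category : category :=
  Category walk_comp1m walk_compm1 walk_compA.

Lemma walk_quotient_invertible (R : hom_rel walk_category) :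
    symmetric e ->
    (forall x y (w : walk x x),
       vertices w = [:: x; y; x] -> congruence R w (walk0 x)) ->
  forall x y (f : @hom (quotient_category R) x y),
  exists g : hom y x, f >>> g = idm x /\ g >>> f = idm y.
Proof.
move=> esym back x y f; rewrite -(hom_reprK f).
case: (hom_repr f) => s sP; rewrite -[exist _ s sP]/(mk_walk sP) {f}.
elim: s x sP => [|z s IHs] x sP.
  have /asboolP/= xy := sP; case: y / xy sP => sP.
  have -> : mk_walk sP = walk0 x by apply: walk_inj.
  exists (idm x); split; exact: comp1m (idm x).
have /andP[/= /andP[xz zs] sy] := sP.
have zsP : is_walk z y s by apply/andP.
have xzP : is_walk x z [:: z] by rewrite /is_walk /= xz; apply/asboolP.
have zxP : is_walk z x [:: x] by rewrite /is_walk /= esym xz; apply/asboolP.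
pose a : @hom (quotient_category R) x z :=
  hom_class R (mk_walk xzP : @hom walk_category x z).
pose b : @hom (quotient_category R) z x :=
  hom_class R (mk_walk zxP : @hom walk_category z x).
have ab : a >>> b = idm x.
  by rewrite /= quotient_compE; apply/hom_classP/(back _ z).
have ba : b >>> a = idm (z : quotient_category R).
  by rewrite /= quotient_compE; apply/hom_classP/(back _ x).
have [g [fg gf]] := IHs z zsP.
set f := hom_class _ _ in fg gf.
have -> : hom_class R (mk_walk sP : @hom walk_category x y) = a >>> f.
  by rewrite /= quotient_compE; congr hom_class; apply: walk_inj.
exact: invertible_comp ab ba fg gf.
Qed.

End Walks.

(* Simple graphs and combinatorial 2-complexes.  A 2-cell is given by the
   closed edge path along which it is attached. *)
Record graph := Graph {
  vertex :> Type;
  adj : rel vertex;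
  adj_sym : symmetric adj;
  adj_irrefl : irreflexive adj }.

Record complex2 := Complex2 {
  skeleton :> graph;
  cell : Type;
  cell_base : cell -> skeleton;
  cell_boundary : forall c, walk (@adj skeleton) (cell_base c) (cell_base c) }.

Definition graph_complex (G : graph) : complex2 :=
  @Complex2 G void (fun c => match c with end) (fun c => match c with end).

Definition subcomplex (K : complex2) (A : cell K -> Prop) : complex2 :=
  @Complex2 K {c : cell K | A c}
    (fun c => cell_base (sval c)) (fun c => cell_boundary (sval c)).

(* Homotopy (rel endpoints) of edge paths is the congruence generated by
   deletion of backtracking and by contraction of the boundaries of 2-cells. *)
Variant homotopy_step (K : complex2) (x y : K)
    (v w : walk (@adj K) x y) : Prop :=
| HomotopyBacktrack z of
    vertices v = [:: x; z; x] & vertices w = [:: x]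
| HomotopyCell c of
    vertices v = vertices (cell_boundary c) & vertices w = [:: x].

Definition homotopy_rel (K : complex2) : hom_rel (walk_category (@adj K)) :=
  @homotopy_step K.

Lemma pi1_invertible (K : complex2)
    (x y : quotient_category (@homotopy_rel K)) (f : hom x y) :
  exists g : hom y x, f >>> g = idm x /\ g >>> f = idm y.
Proof.
apply: walk_quotient_invertible; first exact: adj_sym.
by move=> {f y} {}x y w wE; apply: CongGen; exact: HomotopyBacktrack wE _.
Qed.

Definition pi1 (K : complex2) : groupoid := Groupoid (@pi1_invertible K).

(* [x <@ p] is x theta_p; it associates to the left, so that [x <@ p <@ q] is
   x theta_p theta_q. *)
Reserved Notation "x <@ p" (at level 40, left associativity).

Record projection_algebra := ProjectionAlgebra {
  proj :> Type;
  theta : proj -> proj -> proj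
    where "x <@ p" := (theta p x);
  theta_fix : forall p, p <@ p = p;
  theta_idem : forall p x, x <@ p <@ p = x <@ p;
  theta_swap : forall p q, p <@ q <@ p = q <@ p;
  theta_conj : forall p q x, x <@ p <@ q <@ p = x <@ (q <@ p);
  theta_pqpq : forall p q x, x <@ p <@ q <@ p <@ q = x <@ p <@ q }.

Notation "x <@ p" := (theta p x).

Section ProjectionAlgebra.
Variable P : projection_algebra.
Implicit Types p q e f : P.

Definition proj_le p q : Prop := p = p <@ q.

Definition proj_leF p q : Prop := p = q <@ p.

Definition proj_F : rel P := fun p q => `[< proj_leF p q /\ proj_leF q p >].

Lemma proj_F_sym : symmetric proj_F.
Proof. by move=> p q; apply/asboolP/asboolP => -[]. Qed.

Lemma proj_F_refl : reflexive proj_F.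
Proof. by move=> p; apply/asboolP; rewrite /proj_leF theta_fix. Qed.

Definition path_category : category := walk_category proj_F.

Definition linked p e f : Prop := f = e <@ p <@ f /\ e = f <@ p <@ e.

Lemma linked_sym p e f : linked p e f -> linked p f e.
Proof. by case. Qed.

Lemma linked_F p e f : linked p e f -> proj_F e (e <@ p) /\ proj_F (e <@ p) f.
Proof.
move=> [fE eE]; have epe : e <@ p <@ e = e.
  by rewrite [X in X <@ p <@ e]eE theta_pqpq -eE.
split; apply/asboolP; rewrite /proj_leF; split=> //.
- by rewrite -theta_conj epe.
- by rewrite -theta_conj -eE.
Qed.

Lemma lambdaP p e f : linked p e f -> is_walk proj_F e f [:: e <@ p; f].
Proof.
by move=> /linked_F[eF fF]; rewrite /is_walk /= eF fF; apply/asboolP.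
Qed.

Lemma rhoP p e f : linked p e f -> is_walk proj_F e f [:: f <@ p; f].
Proof.
move=> /linked_sym/linked_F[eF fF].
by rewrite /is_walk /= proj_F_sym fF proj_F_sym eF; apply/asboolP.
Qed.

Definition lambda p e f (h : linked p e f) : @hom path_category e f :=
  mk_walk (lambdaP h).

Definition rho p e f (h : linked p e f) : @hom path_category e f :=
  mk_walk (rhoP h).

Variant chain_step (p r : P) (v w : walk proj_F p r) : Prop :=
| ChainStay of
    vertices v = [:: p; p] & vertices w = [:: p]
| ChainBack q of
    vertices v = [:: p; q; p] & vertices w = [:: p].

Variant reduced_chain_step (e f : P) (v w : walk proj_F e f) : Prop :=
| ReducedChain of chain_step v w
| ReducedLinked p (h : linked p e f) of v = lambda h & w = rho h.

Definition chain_rel : hom_rel path_category := chain_step.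

Definition reduced_chain_rel : hom_rel path_category := reduced_chain_step.

Lemma chain_invertible (x y : quotient_category chain_rel) (f : hom x y) :
  exists g : hom y x, f >>> g = idm x /\ g >>> f = idm y.
Proof.
apply: walk_quotient_invertible; first exact: proj_F_sym.
by move=> {f y} {}x y w wE; apply: CongGen; exact: ChainBack wE _.
Qed.

Lemma reduced_chain_invertible
    (x y : quotient_category reduced_chain_rel) (f : hom x y) :
  exists g : hom y x, f >>> g = idm x /\ g >>> f = idm y.
Proof.
apply: walk_quotient_invertible; first exact: proj_F_sym.
move=> {f y} {}x y w wE; apply: CongGen; apply: ReducedChain.
exact: ChainBack wE _.
Qed.

Definition chain_groupoid : groupoid := Groupoid chain_invertible.

Definition reduced_chain_groupoid : groupoid :=
  Groupoid reduced_chain_invertible.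

Definition special p e f : Prop := proj_le e p \/ proj_le f p.

Definition degenerate p e f (h : linked p e f) : Prop :=
  congruence chain_rel (lambda h) (rho h).

Definition adj_proj : rel P := fun p q => `[< p <> q >] && proj_F p q.

Lemma adj_proj_sym : symmetric adj_proj.
Proof.
move=> p q; rewrite /adj_proj proj_F_sym; congr andb.
by apply/asboolP/asboolP => pq qp; exact: pq.
Qed.

Lemma adj_proj_irrefl : irreflexive adj_proj.
Proof. by move=> p; apply/negbTE; rewrite negb_and asbool_neg negbK asboolT. Qed.

Definition proj_graph : graph := Graph adj_proj_sym adj_proj_irrefl.

(* Removal of the constant steps of the path that starts at x and continues
   along s. *)
Fixpoint drop_constant (x : P) (s : seq P) : seq P :=
  if s is y :: s' then
    if `[< x = y >] then drop_constant y s' else y :: drop_constant y s'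
  else [::].

Lemma drop_constantP x y s :
  is_walk proj_F x y s -> is_walk adj_proj x y (drop_constant x s).
Proof.
elim: s x => [|z s IHs] x //= /andP[/= /andP[xz zs] sy].
have /IHs/andP[zs' sy'] : is_walk proj_F z y s by apply/andP.
case: asboolP => [->|xNz]; first by apply/andP.
by apply/andP; split=> //=; rewrite /adj_proj xz zs' !andbT; apply/asboolP.
Qed.

Record linked_pair := LinkedPair {
  lp_p : P;
  lp_e : P;
  lp_f : P;
  lp_linked : linked lp_p lp_e lp_f }.

Lemma linked_boundaryP (c : linked_pair) :
  let: (p, e, f) := (lp_p c, lp_e c, lp_f c) in
  is_walk proj_F e e [:: e <@ p; f; f <@ p; e].
Proof.
case: c => p e f h /=.
exact: walk_catP (lambdaP h) (lambdaP (linked_sym h)).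
Qed.

Definition linked_boundary (c : linked_pair) :
    walk adj_proj (lp_e c) (lp_e c) :=
  mk_walk (drop_constantP (linked_boundaryP c)).

Definition proj_complex : complex2 :=
  @Complex2 proj_graph linked_pair lp_e linked_boundary.

Definition proj_subcomplex : complex2 :=
  @subcomplex proj_complex (fun c : linked_pair =>
    special (lp_p c) (lp_e c) (lp_f c) /\ ~ degenerate (lp_linked c)).

Lemma stay_degenerate p e f (h : linked p e f) :
  e <@ p = e -> f <@ p = f -> degenerate h.
Proof.
move=> eE fE; have [_ ef] := linked_F h; rewrite eE in ef.
have efP : is_walk proj_F e f [:: f] by rewrite /is_walk /= ef; apply/asboolP.
have eeP : is_walk proj_F e e [:: e].
  by rewrite /is_walk /= proj_F_refl; apply/asboolP.
have ffP : is_walk proj_F f f [:: f].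
  by rewrite /is_walk /= proj_F_refl; apply/asboolP.
pose w : @hom path_category e f := mk_walk efP.
pose u : @hom path_category e e := mk_walk eeP.
pose v : @hom path_category f f := mk_walk ffP.
have lE : lambda h = u >>> w by apply: walk_inj; rewrite /= eE.
have rE : rho h = w >>> v by apply: walk_inj; rewrite /= fE.
have uE : congruence chain_rel u (walk0 _ e) by apply: CongGen; exact: ChainStay.
have vE : congruence chain_rel v (walk0 _ f) by apply: CongGen; exact: ChainStay.
rewrite /degenerate lE rE; apply: (@CongTrans _ _ _ _ _ w).
  by rewrite -[X in congruence _ _ X]comp1m; apply: CongComp (CongRefl _ _).
apply: CongSym; rewrite -[X in congruence _ _ X]compm1.
exact: CongComp (CongRefl _ _) _.
Qed.

Lemma eq_degenerate p e f (h : linked p e f) : e <@ p = f <@ p -> degenerate h.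
Proof.
move=> eE; rewrite /degenerate.
have -> : lambda h = rho h by apply: walk_inj; rewrite /= eE.
exact: CongRefl.
Qed.

(* For the cells of [proj_subcomplex], dropping the constant steps of the
   boundary (e, e', f, f', e) leaves the triangles (e, f, f', e) when e <= p
   and (e, e', f, e) when f <= p. *)
Lemma special_boundary_l p e f (h : linked p e f) :
    ~ degenerate h -> proj_le e p ->
  vertices (linked_boundary (LinkedPair h)) = [:: e; f; f <@ p; e].
Proof.
move=> ndeg eE; rewrite /vertices /= -eE.
have ef : e <> f by move=> ef; apply: ndeg; apply: eq_degenerate; rewrite ef.
have ff : f <> f <@ p by move=> ff; apply: ndeg; apply: stay_degenerate.
have fe : f <@ p <> e.
  by move=> fe; apply: ndeg; apply: eq_degenerate; rewrite fe -eE.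
by rewrite (asboolT (erefl e)) !asboolF.
Qed.

Lemma special_boundary_r p e f (h : linked p e f) :
    ~ degenerate h -> proj_le f p ->
  vertices (linked_boundary (LinkedPair h)) = [:: e; e <@ p; f; e].
Proof.
move=> ndeg fE; rewrite /vertices /= -fE.
have ee : e <> e <@ p by move=> ee; apply: ndeg; apply: stay_degenerate.
have ef : e <@ p <> f.
  by move=> ef; apply: ndeg; apply: eq_degenerate; rewrite ef -fE.
have fe : f <> e by move=> fe; apply: ndeg; apply: eq_degenerate; rewrite fe.
by rewrite (asboolT (erefl f)) !asboolF.
Qed.

End ProjectionAlgebra.

(* Main.v *)
From mathcomp Require Import all_boot.
From mathcomp Require Import boolp.
Require Import Defs.

Set Implicit Arguments.
Unset Strict Implicit.
Unset Printing Implicit Defensive.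

(** Both sides of every isomorphism are quotients of categories of walks on the
    vertex set [P]: walks for the reflexive relation F for the chain groupoids,
    walks along edges of the graph, where constant steps are forbidden, for the
    fundamental groupoids.  Deleting constant steps is a functor from the former
    to the latter.  It is full, and the relation [(p, p) ~ (p)] makes it faithful
    modulo congruence ([incl_drop_walk]); so a congruence on paths that contains
    the chain congruence has the same quotient as the homotopy relation of a
    complex on the same graph as soon as the extra generators and the 2-cells
    can be derived from each other ([path_quotient_pi1]).

    Without 2-cells and extra generators this is the first isomorphism.  For the
    second, note that the boundary [(e, e', f, f', e)] of the cell of a linked
    pair is [lambda] from e to f followed by the reverse of [rho]; hence
    contracting this boundary amounts to identifying [lambda] with [rho]
    ([congruence_eq_inverse]).

    For the third, let [(e, f)] be p-linked.  The vertices e' and f' are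
    F-related, and the diagonal from e' to f' cuts the square of [(e, f)] into
    two triangles, whose boundaries are, up to constant steps, those of the
    cells of the p-linked pairs [(e', f)] and [(e, f')].  These pairs are special, since [e' <= p] and [f' <= p].  A
    degenerate pair contributes nothing, as its relation already follows from
    the chain congruence.  So the nondegenerate special pairs generate the full
    congruence ([reduced_special]), and all cells of the large complex contract
    in the small one. *)

(** * Congruences and quotient categories *)

Lemma congruence_fmap (C D : category) (F : functor C D) (R : hom_rel C)
    (S : hom_rel D) :
    (forall x y (f g : hom x y),
      R x y f g -> congruence S (fmap F f) (fmap F g)) ->
  forall x y (f g : hom x y),
  congruence R f g -> congruence S (fmap F f) (fmap F g).
Proof.
move=> RS x y f g; elim=> {x y f g} [x y f g|x y f|x y f g _|x y f g h _ fg _|].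
- exact: RS.
- exact: CongRefl.
- exact: CongSym.
- exact: CongTrans fg.
- by move=> x y z f f' g g' _ ff' _ gg'; rewrite !fmapM; apply: CongComp.
Qed.

Definition id_functor (C : category) : functor C C :=
  @Functor C C id (fun x y => id) (fun x => erefl) (fun x y z f g => erefl).

Lemma congruence_sub (C : category) (R S : hom_rel C) :
    (forall x y (f g : hom x y), R x y f g -> congruence S f g) ->
  forall x y (f g : hom x y), congruence R f g -> congruence S f g.
Proof. exact: (congruence_fmap (F := id_functor C)). Qed.

(** Used with [f], [f'] the paths [lambda], [rho] and [g] the reverse of [rho],
    to pass from contractible cells to identified paths. *)
Lemma congruence_eq_inverse (C : category) (R : hom_rel C) (x y : C)
    (f f' : hom x y) (g : hom y x) :
    congruence R (f >>> g) (idm x) -> congruence R (g >>> f') (idm y) ->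
  congruence R f f'.
Proof.
move=> fg gf'; rewrite -[f]compm1 -[f']comp1m.
apply: (@CongTrans _ _ _ _ _ (f >>> g >>> f')).
  by rewrite -compA; apply: CongComp (CongRefl _ _) (CongSym gf').
exact: CongComp fg (CongRefl _ _).
Qed.

(** Fullness is only asked up to [S], so a preimage has to be chosen to define
    the inverse on morphisms; faithfulness makes the choice irrelevant. *)
Lemma quotient_functor_iso (C D : category) (R : hom_rel C) (S : hom_rel D)
    (F : functor C D) :
    bijective (fobj F) ->
    (forall x y (f g : hom x y),
      congruence R f g <-> congruence S (fmap F f) (fmap F g)) ->
    (forall x y (g : hom (F x) (F y)), exists f, congruence S (fmap F f) g) ->
  exists Q : functor (quotient_category R) (quotient_category S),
    bijective (fobj Q) /\ forall x y, bijective (@fmap _ _ Q x y).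
Proof.
move=> Fbij RS full.
pose m (x y : quotient_category R) (u : hom x y) :
    @hom (quotient_category S) (F x) (F y) :=
  hom_class S (fmap F (hom_repr u)).
have mE x y (f : @hom C x y) : m x y (hom_class R f) = hom_class S (fmap F f).
  by apply/hom_classP/RS/hom_classP; rewrite hom_reprK.
have m1 x : m x x (idm x) = idm (F x : quotient_category S).
  by rewrite /= mE fmap1.
have mM x y z (u : @hom (quotient_category R) x y) (v : hom y z) :
    m x z (u >>> v) = m x y u >>> m y z v.
  by rewrite /= [RHS]quotient_compE mE fmapM.
exists (@Functor (quotient_category R) (quotient_category S) F m m1 mM).
split=> // x y /=.
pose n (v : @hom (quotient_category S) (F x) (F y)) :
    @hom (quotient_category R) x y :=
  hom_class R (sval (cid (full x y (hom_repr v)))).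
exists n => [u|v]; rewrite /n; case: cid => f /= fE.
  rewrite -[RHS]hom_reprK; apply/hom_classP/RS/(CongTrans fE).
  by apply/hom_classP; rewrite hom_reprK.
by rewrite mE -[RHS]hom_reprK; apply/hom_classP.
Qed.

(** A cell relation between walks from [x] to [y] forces both [x] and [y] to be
    the base point, but only propositionally; this elimination principle hides
    the transport. *)
Lemma cell_step_ind (K : complex2) (c : cell K)
    (Q : forall x y : K, walk (@adj K) x y -> walk (@adj K) x y -> Prop)
    (x y : K) (v w : walk (@adj K) x y) :
    vertices v = vertices (cell_boundary c) -> vertices w = [:: x] ->
  Q _ _ (cell_boundary c) (walk0 _ (cell_base c)) -> Q x y v w.
Proof.
move=> [xE vE] [wE] Qc; have /andP[_ /asboolP] := valP w; rewrite [val w]wE /= => xy.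
subst x; subst y.
by rewrite (walk_inj vE) (walk_inj (w := w) (w' := walk0 _ _)).
Qed.

(** * Paths modulo the chain congruence *)

Section ProjectionPaths.
Variable P : projection_algebra.

Local Notation adjP := (@adj_proj P).
Local Notation ppath := (path_category P).
Local Notation edge_path := (walk_category adjP).

Lemma stepP (x y : P) : proj_F x y -> is_walk (@proj_F P) x y [:: y].
Proof. by move=> xy; rewrite /is_walk /= xy; apply/asboolP. Qed.

Definition step (x y : P) (xy : proj_F x y) : @hom ppath x y :=
  mk_walk (stepP xy).

(** The generator [(p, p) ~ (p)] only removes a constant step from a path of
    length one; here it acts in the middle of any path. *)
Lemma chain_insert_stay (x y z : P) (a : @hom ppath x y) (b : @hom ppath y z)
    (c : @hom ppath x z) :
  val c = val a ++ y :: val b -> congruence (@chain_rel P) c (a >>> b).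
Proof.
move=> cE; pose s := step (proj_F_refl y).
have -> : c = a >>> s >>> b by apply: walk_inj; rewrite cE /= -catA.
apply: CongComp (CongRefl _ _); rewrite -[X in congruence _ _ X]compm1.
apply: CongComp (CongRefl _ _) (CongGen _).
exact: ChainStay.
Qed.

Lemma chain_backtrack2 (x y z : P) (a : @hom ppath x z) (b : @hom ppath z x) :
    vertices a = [:: x; y; z] -> vertices b = [:: z; y; x] ->
  congruence (@chain_rel P) (a >>> b) (idm (x : ppath)).
Proof.
move=> [aE] [bE].
have [xy yz] : proj_F x y /\ proj_F y z.
  by have := valP a; rewrite /is_walk [val a]aE /= => /andP[/and3P[]].
have yx : proj_F y x by rewrite proj_F_sym.
have zy : proj_F z y by rewrite proj_F_sym.
have -> : a >>> b = step xy >>> (step yz >>> step zy) >>> step yx.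
  by apply: walk_inj; rewrite /= aE bE.
apply: (@CongTrans _ _ _ _ _ (step xy >>> idm (y : ppath) >>> step yx)).
  apply: CongComp (CongRefl _ _); apply: CongComp (CongRefl _ _) (CongGen _).
  exact: (ChainBack (q := z)).
by rewrite compm1; apply: CongGen; exact: (ChainBack (q := y)).
Qed.

(** [lambda (linked_sym h)] visits the vertices of [rho h] in reverse order, so
    the two are inverse to each other. *)
Lemma rho_lambda_sym (p e f : P) (h : linked p e f) :
  congruence (@chain_rel P) (rho h >>> lambda (linked_sym h)) (idm (e : ppath)).
Proof. exact: (@chain_backtrack2 _ (f <@ p)). Qed.

Lemma lambda_sym_rho (p e f : P) (h : linked p e f) :
  congruence (@chain_rel P) (lambda (linked_sym h) >>> rho h) (idm (f : ppath)).
Proof. exact: (@chain_backtrack2 _ (f <@ p)). Qed.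

(** * Dropping constant steps *)

Lemma drop_constant_cat (x : P) (s t : seq P) :
  drop_constant x (s ++ t) = drop_constant x s ++ drop_constant (last x s) t.
Proof. by elim: s x => //= y s IHs x; rewrite IHs; case: ifP. Qed.

Lemma drop_constant_id (x : P) (s : seq P) :
  path adjP x s -> drop_constant x s = s.
Proof.
elim: s x => //= y s IHs x /andP[/andP[/asboolP xy _] /IHs ->].
by rewrite asboolF.
Qed.

Definition drop_walk (x y : P) (w : walk (@proj_F P) x y) : walk adjP x y :=
  mk_walk (drop_constantP (valP w)).

Lemma drop_walk1 (x : P) : drop_walk (walk0 _ x) = walk0 _ x.
Proof. exact: walk_inj. Qed.

Lemma drop_walkM (x y z : P) (u : walk (@proj_F P) x y) (v : walk (@proj_F P) y z) :
  drop_walk (walk_comp u v) = walk_comp (drop_walk u) (drop_walk v).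
Proof.
apply: walk_inj; rewrite /= drop_constant_cat.
by have /andP[_ /asboolP ->] := valP u.
Qed.

Definition drop : functor ppath edge_path :=
  @Functor ppath edge_path id drop_walk drop_walk1 drop_walkM.

Lemma adj_walkP (x y : P) (s : seq P) :
  is_walk adjP x y s -> is_walk (@proj_F P) x y s.
Proof.
move=> /andP[xs sy]; rewrite /is_walk sy andbT; apply: sub_path xs => a b.
by case/andP.
Qed.

Definition incl_walk (x y : P) (w : walk adjP x y) : walk (@proj_F P) x y :=
  mk_walk (adj_walkP (valP w)).

Lemma incl_walk1 (x : P) : incl_walk (walk0 _ x) = walk0 _ x.
Proof. exact: walk_inj. Qed.

Lemma incl_walkM (x y z : P) (u : walk adjP x y) (v : walk adjP y z) :
  incl_walk (walk_comp u v) = walk_comp (incl_walk u) (incl_walk v).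
Proof. exact: walk_inj. Qed.

Definition incl : functor edge_path ppath :=
  @Functor edge_path ppath id incl_walk incl_walk1 incl_walkM.

Lemma incl_walkK (x y : P) (w : walk adjP x y) : drop_walk (incl_walk w) = w.
Proof.
by apply: walk_inj; apply: drop_constant_id; case/andP: (valP w).
Qed.

(** This is where the generators [(p, p) ~ (p)] of the chain congruence are
    used: they allow the constant steps to be put back one at a time. *)
Lemma incl_drop_walk (x y : P) (w : @hom ppath x y) :
  congruence (@chain_rel P) (incl_walk (drop_walk w)) w.
Proof.
case: w => s sP; rewrite -[exist _ s sP]/(mk_walk sP).
elim: s x sP => [|z s IHs] x sP.
  by rewrite [incl_walk _](_ : _ = mk_walk sP); [exact: CongRefl|exact: walk_inj].
have /andP[/= /andP[xz zs] sy] := sP.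
have zsP : is_walk (@proj_F P) z y s by apply/andP.
have [xEz|xNz] := pselect (x = z).
  case: z / xEz xz zs sy sP zsP => _ _ _ sP xsP.
  rewrite [incl_walk _](_ : _ = incl_walk (drop_walk (mk_walk xsP))); last first.
    by apply: walk_inj; rewrite /= asboolT.
  apply: CongTrans (IHs x xsP) (CongSym _).
  by rewrite -[X in congruence _ _ X](@comp1m ppath); apply: chain_insert_stay.
rewrite [incl_walk _](_ : _ =
    step xz >>> (incl_walk (drop_walk (mk_walk zsP)) : @hom ppath z y)); last first.
  by apply: walk_inj; rewrite /= asboolF.
rewrite [X in congruence _ _ X](_ : _ = step xz >>> (mk_walk zsP : @hom ppath z y)).
  exact: CongComp (CongRefl _ _) (IHs _ _).
exact: walk_inj.
Qed.

(** * Complexes on the projection graph *)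

Section Complex.
Variables (I : Type) (base : I -> P) (bd : forall c, walk adjP (base c) (base c)).

Let K : complex2 := @Complex2 (proj_graph P) I base bd.

Lemma drop_chain_step (x y : P) (u v : @hom ppath x y) :
  chain_step u v ->
  congruence (@homotopy_rel K : hom_rel edge_path) (drop_walk u) (drop_walk v).
Proof.
have refl s t : val u = s -> val v = t ->
    drop_constant x s = drop_constant x t ->
    congruence (@homotopy_rel K : hom_rel edge_path) (drop_walk u) (drop_walk v).
  move=> uE vE st; rewrite (_ : drop_walk u = drop_walk v); first exact: CongRefl.
  by apply: walk_inj; rewrite /= uE vE.
case=> [[uE] [vE]|q [uE] [vE]].
  by apply: refl uE vE _; rewrite /= asboolT.
have [xq|xq] := pselect (x = q).
  (* The path (x, x, x) becomes constant, instead of a backtrack. *)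
  by apply: refl uE vE _; rewrite -xq /= asboolT.
apply: CongGen; apply: (@HomotopyBacktrack K x y _ _ q).
  2: by rewrite /vertices /= vE.
by rewrite /vertices /= uE /= !asboolF // => /esym.
Qed.

Lemma drop_chain (x y : P) (u v : @hom ppath x y) :
  congruence (@chain_rel P) u v ->
  congruence (@homotopy_rel K : hom_rel edge_path) (drop_walk u) (drop_walk v).
Proof.
apply: (congruence_fmap (F := drop)) => a b f g; exact: drop_chain_step.
Qed.

(** The boundary of the cell is [lambda h] followed by an inverse of [rho h]. *)
Lemma drop_linked (p e f : P) (h : linked p e f) :
    congruence (@homotopy_rel K : hom_rel edge_path)
      (linked_boundary (LinkedPair h)) (walk0 _ e) ->
  congruence (@homotopy_rel K : hom_rel edge_path)
    (drop_walk (lambda h)) (drop_walk (rho h)).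
Proof.
pose g := drop_walk (lambda (linked_sym h)).
have -> : linked_boundary (LinkedPair h) = walk_comp (drop_walk (lambda h)) g.
  by rewrite -drop_walkM; apply: walk_inj.
move=> bd1; apply: (@congruence_eq_inverse edge_path) bd1 _.
by have := drop_chain (lambda_sym_rho h); rewrite /= drop_walkM drop_walk1.
Qed.

(** The complex and the congruence [T] are kept independent so that the same
    comparison serves the graph, with the chain congruence, and the complex of
    all linked pairs, with the reduced one. *)
Lemma path_quotient_pi1 (T : hom_rel ppath) :
    (forall x y (u v : walk (@proj_F P) x y), chain_step u v -> T x y u v) ->
    (forall x y (u v : walk (@proj_F P) x y), T x y u v ->
      congruence (@homotopy_rel K : hom_rel edge_path) (drop_walk u) (drop_walk v)) ->
    (forall c : I, congruence T (incl_walk (bd c)) (walk0 _ (base c))) ->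
  exists Q : functor (quotient_category T) (quotient_category (@homotopy_rel K)),
    bijective (fobj Q) /\ forall x y, bijective (@fmap _ _ Q x y).
Proof.
move=> chT Tdrop cellT.
have chainT x y (u v : @hom ppath x y) :
    congruence (@chain_rel P) u v -> congruence T u v.
  by apply: congruence_sub => a b f g fg; apply: CongGen; exact: chT.
have inclT x y (u v : @hom edge_path x y) :
    congruence (@homotopy_rel K : hom_rel edge_path) u v ->
    congruence T (incl_walk u) (incl_walk v).
  apply: (congruence_fmap (F := incl)) => a b s t /= [z uE vE|c uE vE].
    by apply/chainT/CongGen; exact: (ChainBack (q := z)).
  apply: (cell_step_ind (K := K) (c := c)
    (Q := fun x y u v => congruence T (incl_walk u) (incl_walk v)) uE vE).
  by rewrite incl_walk1.
apply: (@quotient_functor_iso _ _ T (@homotopy_rel K : hom_rel edge_path) drop).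
- by exists id.
- move=> x y f g; split; first exact: (congruence_fmap (F := drop)).
  move=> /inclT fg.
  apply: CongTrans (chainT _ _ _ _ (incl_drop_walk g)).
  exact: CongTrans (CongSym (chainT _ _ _ _ (incl_drop_walk f))) fg.
- move=> x y g; exists (incl_walk g); rewrite /= incl_walkK; exact: CongRefl.
Qed.

End Complex.

(** * Special linked pairs *)

Lemma chain_reduced (x y : P) (u v : @hom ppath x y) :
  congruence (@chain_rel P) u v -> congruence (@reduced_chain_rel P) u v.
Proof.
by apply: congruence_sub => a b s t st; apply: CongGen; apply: ReducedChain.
Qed.

Lemma linked_boundary_reduced (c : linked_pair P) :
  congruence (@reduced_chain_rel P)
    (lambda (lp_linked c) >>> lambda (linked_sym (lp_linked c)))
    (idm (lp_e c : ppath)).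
Proof.
case: c => p e f h /=.
apply: (@CongTrans _ _ _ _ _ (rho h >>> lambda (linked_sym h))).
  by apply: CongComp (CongRefl _ _); apply: CongGen; exact: (ReducedLinked (h := h)).
exact/chain_reduced/rho_lambda_sym.
Qed.

Lemma linked_boundaryE (c : linked_pair P) :
  linked_boundary c =
  drop_walk (lambda (lp_linked c) >>> lambda (linked_sym (lp_linked c))).
Proof. exact: walk_inj. Qed.

(** Every linked pair [(e, f)] yields the special one [(e', f)]; by symmetry it
    also yields [(e, f')]. *)
Lemma linked_theta (p e f : P) : linked p e f -> linked p (e <@ p) f.
Proof.
move=> [fE eE]; split; first by rewrite theta_idem.
by rewrite -theta_conj theta_idem -eE.
Qed.

Variant special_chain_step (e f : P) (v w : walk (@proj_F P) e f) : Prop :=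
| SpecialChain of chain_step v w
| SpecialLinked p (h : linked p e f) of
    special p e f & ~ degenerate h & v = lambda h & w = rho h.

Definition special_chain_rel : hom_rel ppath := special_chain_step.

Lemma chain_special (x y : P) (u v : @hom ppath x y) :
  congruence (@chain_rel P) u v -> congruence special_chain_rel u v.
Proof.
by apply: congruence_sub => a b s t uv; apply: CongGen; apply: SpecialChain.
Qed.

Lemma special_linked (p e f : P) (h : linked p e f) :
  special p e f -> congruence special_chain_rel (lambda h) (rho h).
Proof.
move=> sp; have [dh|ndh] := pselect (degenerate h); first exact: chain_special.
by apply: CongGen; exact: (SpecialLinked (h := h)).
Qed.

(** The relation of [(e, f)] is that of [(e', f)] followed by that of
    [(e, f')]:
    [(e, e', f) ~ (e, e', e', f) ~ (e, e', f', f) ~ (e, f', f', f) ~ (e, f', f)]. *)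
Lemma reduced_special (x y : P) (u v : @hom ppath x y) :
  congruence (@reduced_chain_rel P) u v -> congruence special_chain_rel u v.
Proof.
apply: congruence_sub => {x y u v} e f u v [uv|p h -> ->].
  by apply: CongGen; apply: SpecialChain.
have h1 : linked p (e <@ p) f := linked_theta h.
have h2 : linked p e (f <@ p) := linked_sym (linked_theta (linked_sym h)).
have [ee' e'f] := linked_F h; have [ff' f'e] := linked_F (linked_sym h).
have f'f : proj_F (f <@ p) f by rewrite proj_F_sym.
apply: (@CongTrans _ _ _ _ _ (step ee' >>> lambda h1)).
  apply/chain_special/CongSym.
  rewrite [X in congruence _ _ X](_ : _ = step ee' >>> step e'f); last first.
    exact: walk_inj.
  by apply: chain_insert_stay; rewrite /= theta_idem.
apply: (@CongTrans _ _ _ _ _ (step ee' >>> rho h1)).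
  apply: CongComp (CongRefl _ _) (special_linked _ _).
  by left; rewrite /proj_le theta_idem.
have -> : step ee' >>> rho h1 = lambda h2 >>> step f'f by apply: walk_inj.
apply: (@CongTrans _ _ _ _ _ (rho h2 >>> step f'f)).
  apply: CongComp (special_linked _ _) (CongRefl _ _).
  by right; rewrite /proj_le theta_idem.
have ef' : proj_F e (f <@ p) by rewrite proj_F_sym.
rewrite [X in congruence _ _ X](_ : _ = step ef' >>> step f'f); last first.
  exact: walk_inj.
by apply/chain_special/chain_insert_stay; rewrite /= theta_idem.
Qed.

Lemma subcomplex_boundary (c : linked_pair P) :
  congruence (@homotopy_rel (proj_subcomplex P)) (linked_boundary c)
    (walk0 _ (lp_e c)).
Proof.
rewrite linked_boundaryE -drop_walk1.
have /= := reduced_special (linked_boundary_reduced c).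
apply: (congruence_fmap (F := drop)) => x y u v [uv|p h sp ndeg -> ->].
  exact: drop_chain_step uv.
apply: drop_linked; apply: CongGen.
pose c' : cell (proj_subcomplex P) := exist _ (LinkedPair h) (conj sp ndeg).
exact: (@HomotopyCell (proj_subcomplex P) _ _ _ _ c').
Qed.

Lemma homotopy_subcomplex (x y : P) (u v : @hom edge_path x y) :
  congruence (@homotopy_rel (proj_complex P)) u v <->
  congruence (@homotopy_rel (proj_subcomplex P)) u v.
Proof.
split; apply: congruence_sub => a b s t [z uE vE|c uE vE].
- by apply: CongGen; exact: (@HomotopyBacktrack (proj_subcomplex P) _ _ _ _ z).
- apply: (cell_step_ind (K := proj_complex P) (c := c)
    (Q := fun x y u v => congruence (@homotopy_rel (proj_subcomplex P)) u v) uE vE).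
  exact: subcomplex_boundary.
- by apply: CongGen; exact: (@HomotopyBacktrack (proj_complex P) _ _ _ _ z).
- by apply: CongGen; exact: (@HomotopyCell (proj_complex P) _ _ _ _ (sval c)).
Qed.

End ProjectionPaths.

Theorem theorem10p6 (P : projection_algebra) :
  chain_groupoid P ≅ pi1 (graph_complex (proj_graph P)) /\
  (reduced_chain_groupoid P ≅ pi1 (proj_complex P) /\
   pi1 (proj_complex P) ≅ pi1 (proj_subcomplex P)).
Proof.
split; last split.
- apply: (@path_quotient_pi1 P void) => //; exact: drop_chain_step.
- apply: path_quotient_pi1.
  + by move=> x y u v; apply: ReducedChain.
  + move=> x y u v [uv|p h -> ->]; first exact: drop_chain_step.
    apply: drop_linked; apply: CongGen.
    exact: (@HomotopyCell (proj_complex P) _ _ _ _ (LinkedPair h)).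
  + move=> c; rewrite linked_boundaryE.
    apply: CongTrans (linked_boundary_reduced c).
    exact/chain_reduced/incl_drop_walk.
- apply: (@quotient_functor_iso _ _ _ _ (id_functor (walk_category (@adj_proj P)))).
  + by exists id.
  + exact: homotopy_subcomplex.
  + by move=> x y g; exists g; exact: CongRefl.
Qed.
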